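(* Let $(f_i)_{i\in\mathbb{Z}}$ be a family of probability kernels $f_i:\mathcal{F}_{\le i}\times\Omega\to[0,1]$ such that for each $i\in\mathbb{Z}$: (a) for each $A\in\mathcal{F}_{\le i}$, the function $f_i(A\mid\cdot\,)$ is $\mathcal{F}_{\le i-1}$-measurable; (b) for each $B\in\mathcal{F}_{\le i-1}$ and $\omega\in\Omega$, $f_i(B\mid\omega)=\mathbf{1}_B(\omega)$. For $\Lambda\in\mathcal{S}_b$ define $$f_\Lambda \;=\; f_{l_\Lambda}\, f_{l_\Lambda+1}\cdots f_{m_\Lambda}$$ (composition of kernels, acting on $\mathcal{F}_{\le m_\Lambda}$-measurable functions). Then $f=\{f_\Lambda\}_{\Lambda\in\mathcal{S}_b}$ is a left interval-specification, and it is the unique left interval-specification such that $f_{\{i\}}=f_i$ for all $i\in\mathbb{Z}$. Furthermore, $$\mathcal{G}(f)=\Bigl\{\mu \text{ probability measure on }(\Omega,\mathcal{F}) : \mu f_i=\mu \text{ on } \mathcal{F}_{\le i} \text{ for all } i\in\mathbb{Z}\Bigr\}.$$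
   Context: Let $(E,\mathcal{E})$ be a measurable space and $\Omega\subset E^{\mathbb{Z}}$ a set of (admissible) configurations, endowed with the $\sigma$-algebra $\mathcal{F}$ which is the restriction to $\Omega$ of the product $\sigma$-algebra. For $\Lambda\subset\mathbb{Z}$, $\mathcal{F}_\Lambda\subset\mathcal{F}$ is the $\sigma$-algebra generated by the coordinates $\omega\mapsto\omega_i$, $i\in\Lambda$; $\mathcal{F}_{\le n}=\mathcal{F}_{]-\infty,n]}$. $\mathcal{S}_b$ is the set of (nonempty) finite intervals of $\mathbb{Z}$; for $\Lambda\in\mathcal{S}_b$, $l_\Lambda=\min\Lambda$, $m_\Lambda=\max\Lambda$, $\Lambda_-=\,]-\infty,l_\Lambda-1]$. A probability kernel $f_\Lambda:\mathcal{F}_{\le m}\times\Omega\to[0,1]$ is a map such that $f_\Lambda(\cdot\mid\omega)$ is a probability measure on $(\Omega,\mathcal{F}_{\le m})$ for each $\omega$ and $f_\Lambda(A\mid\cdot)$ is measurable for each $A$. Write $f_\Lambda(h\mid\omega)=(f_\Lambda h)(\omega)=\int h(\sigma)f_\Lambda(d\sigma\mid\omega)$. Compositions: $(f_\Delta f_\Lambda)(h\mid\omega)=\int\!\int h(\xi) f_\Lambda(d\xi\mid\sigma)f_\Delta(d\sigma\mid\omega)$, and $(\mu f_\Lambda)(h)=\mu(f_\Lambda h)$ for a measure $\mu$. A left interval-specification (LIS) on $(\Omega,\mathcal{F})$ is a family $f=\{f_\Lambda\}_{\Lambda\in\mathcal{S}_b}$ of probability kernels $f_\Lambda:\mathcal{F}_{\le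 m_\Lambda}\times\Omega\to[0,1]$ such that for all $\Lambda\in\mathcal{S}_b$: (a) for each $A\in\mathcal{F}_{\le m_\Lambda}$, $f_\Lambda(A\mid\cdot)$ is $\mathcal{F}_{\Lambda_-}$-measurable; (b) for each $B\in\mathcal{F}_{\Lambda_-}$ and $\omega\in\Omega$, $f_\Lambda(B\mid\omega)=\mathbf{1}_B(\omega)$; (c) for each $\Delta\in\mathcal{S}_b$ with $\Delta\supset\Lambda$, $f_\Delta f_\Lambda=f_\Delta$ on $\mathcal{F}_{\le m_\Lambda}$, i.e. $(f_\Delta f_\Lambda)(h\mid\omega)=f_\Delta(h\mid\omega)$ for each $\mathcal{F}_{\le m_\Lambda}$-measurable $h$ and each $\omega\in\Omega$. A probability measure $\mu$ on $(\Omega,\mathcal{F})$ is consistent with $f$ (a chain consistent with $f$) if $\mu f_\Lambda=\mu$ on $\mathcal{F}_{\le m_\Lambda}$ for every $\Lambda\in\mathcal{S}_b$. $\mathcal{G}(f)$ denotes the set of all such measures. *)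

(* Defs.v *)
From HB Require Import structures.
From mathcomp Require Import all_boot all_order all_algebra.
From mathcomp Require Import all_classical all_reals all_analysis.
From mathcomp Require Import measurable_realfun.

Set Implicit Arguments.
Unset Strict Implicit.
Unset Printing Implicit Defensive.

Import Order.TTheory GRing.Theory Num.Theory.

Local Open Scope classical_set_scope.
Local Open Scope ring_scope.
Local Open Scope ereal_scope.

(* The events {X_i \in B}, for i in L and B measurable. *)
Definition coord_events (d : measure_display) (E : measurableType d)
    (T : Type) (X : int -> T -> E) (L : set int) : set (set T) :=
  \bigcup_(i in L) preimage_set_system setT (X i) measurable.

(* E^Z with the product sigma-algebra. *)
Definition path_space (d : measure_display) (E : measurableType d) :=
  g_sigma_algebraType
    (coord_events (fun (i : int) (w : int -> E) => w i) setT).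

(* Omega as a type. Measurable types are pointed in the library, whence the
   proof ne that Omega is not empty. *)
Definition config (d : measure_display) (E : measurableType d)
  (Omega : set (int -> E)) (ne : Omega !=set0) : Type := set_type Omega.

Section configurations.
Context (d : measure_display) (E : measurableType d).
Context (Omega : set (int -> E)) (ne : Omega !=set0).

HB.instance Definition _ := Choice.on (config ne).

HB.instance Definition _ :=
  isPointed.Build (config ne) (SigSub (mem_set (svalP (cid ne)))).

Definition coord (i : int) (w : config ne) : E := val w i.

(* (Omega, F): the members of F are the traces on Omega of the members of the
   product sigma-algebra. *)
Definition confs :=
  g_sigma_algebra_preimageType (val : config ne -> path_space E).

(* (Omega, F_L), with F_L generated by the coordinates in L. *)
Definition confs_on (L : set int) :=
  g_sigma_algebraType (coord_events coord L).

End configurations.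

(* ]-oo, m]; thus confs_on ne (below m) is (Omega, F_{<= m}). *)
Definition below (m : int) : set int := [set i : int | (i <= m)%R].

(* The nonempty finite interval {lo, lo + 1, ..., lo + len} of Z. *)
Record fin_itv := FinItv { lo : int ; len : nat }.

Definition hi (L : fin_itv) : int := (lo L + (len L)%:Z)%R.

Definition points (L : fin_itv) : set int :=
  [set i : int | (lo L <= i <= hi L)%R].

Definition past (L : fin_itv) : set int := below (lo L - 1)%R.

(* Note that hi (singleton i) is i + 0, which is equal but not convertible
   to i. *)
Definition singleton (i : int) : fin_itv := FinItv i 0.

(* mu(h) makes sense: h is nonnegative (possibly with infinite values) or
   mu-integrable. The latter covers the bounded measurable functions when mu
   is a probability measure. *)
Definition has_integral (R : realType) (d : measure_display)
    (T : measurableType d) (mu : {measure set T -> \bar R})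
    (h : T -> \bar R) : Prop :=
  (forall w, 0 <= h w) \/ mu.-integrable setT h.

Section kernels.
Context (R : realType) (d : measure_display) (E : measurableType d).
Context (Omega : set (int -> E)) (ne : Omega !=set0).

(* (k h)(w) = \int h(s) k(ds | w) *)
Definition kact (L : set int) (k : R.-pker (confs ne) ~> (confs_on ne L))
    (h : config ne -> \bar R) (w : config ne) : \bar R :=
  \int[k w]_s h s.

(* For each event A of F_L, k(A | .) is F_M-measurable. *)
Definition kernel_measurable (M L : set int)
    (k : R.-pker (confs ne) ~> (confs_on ne L)) : Prop :=
  forall A : set (confs_on ne L), measurable A ->
    measurable_fun [set: confs_on ne M] (k ^~ A : confs_on ne M -> \bar R).

(* k(B | w) = 1_B(w) for each event B of F_M; meant for M included in L. *)
Definition kernel_proper (M L : set int)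
    (k : R.-pker (confs ne) ~> (confs_on ne L)) : Prop :=
  forall B : set (confs_on ne M), measurable B ->
    forall w : config ne, k w B = (\1_B w)%:E.

(* If k2(A | .) is F_M-measurable for each A, then k2 can be read as a kernel
   with source (Omega, F_M), and composed with a kernel k1 with target
   (Omega, F_M): (k1 k2)(A | w) = \int k2(A | s) k1(ds | w). *)
Section composition.
Context (M L : set int) (k1 : R.-pker (confs ne) ~> (confs_on ne M)).
Context (k2 : R.-pker (confs ne) ~> (confs_on ne L)).
Context (mk2 : kernel_measurable M k2).

Definition ksource : confs_on ne M -> {measure set (confs_on ne L) -> \bar R}
  := k2.

HB.instance Definition _ := isKernel.Build _ _ _ _ R ksource mk2.

Let ksource1 (w : confs_on ne M) : ksource w [set: confs_on ne L] = 1.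
Proof. exact: (@prob_kernel _ _ _ _ _ k2 w). Qed.

HB.instance Definition _ :=
  Kernel_isProbability.Build _ _ _ _ R ksource ksource1.

Definition kcompose : confs ne -> {measure set (confs_on ne L) -> \bar R} :=
  mkcomp_noparam k1 ksource.

Let kcompose_measurable (A : set (confs_on ne L)) : measurable A ->
  measurable_fun [set: confs ne] (kcompose ^~ A).
Proof. exact: measurable_kernel. Qed.

HB.instance Definition _ := isKernel.Build _ _ _ _ R kcompose
  kcompose_measurable.

Let kcompose1 (w : confs ne) : kcompose w [set: confs_on ne L] = 1.
Proof.
rewrite /kcompose /mkcomp_noparam /= /kcomp_noparam.
under eq_integral do rewrite prob_kernel.
by rewrite integral_cst// prob_kernel mule1.
Qed.

HB.instance Definition _ :=
  Kernel_isProbability.Build _ _ _ _ R kcompose kcompose1.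

End composition.

Lemma kernel_measurable_succ
    (f : forall i : int, R.-pker (confs ne) ~> (confs_on ne (below i)))
    (fa : forall i : int, kernel_measurable (below (i - 1)%R) (f i))
    (l : int) (n : nat) :
  kernel_measurable (below (l + n%:Z)%R) (f (l + n.+1%:Z)%R).
Proof.
have -> : (l + n%:Z = l + n.+1%:Z - 1)%R by rewrite -addn1 PoszD addrA addrK.
exact: fa.
Qed.

(* f_l f_{l+1} ... f_{l+n}, associated to the left. *)
Fixpoint kproduct_from
    (f : forall i : int, R.-pker (confs ne) ~> (confs_on ne (below i)))
    (fa : forall i : int, kernel_measurable (below (i - 1)%R) (f i))
    (l : int) (n : nat) :
    R.-pker (confs ne) ~> (confs_on ne (below (l + n%:Z)%R)) :=
  match n with
  | 0%N => f (l + 0%:Z)%R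
  | p.+1 => kcompose (kproduct_from fa l p) (@kernel_measurable_succ f fa l p)
  end.

Definition interval_kernel
    (f : forall i : int, R.-pker (confs ne) ~> (confs_on ne (below i)))
    (fa : forall i : int, kernel_measurable (below (i - 1)%R) (f i))
    (L : fin_itv) : R.-pker (confs ne) ~> (confs_on ne (below (hi L))) :=
  kproduct_from fa (lo L) (len L).

Definition left_interval_specification
    (f : forall L : fin_itv,
       R.-pker (confs ne) ~> (confs_on ne (below (hi L)))) : Prop :=
  forall L : fin_itv,
    [/\ kernel_measurable (past L) (f L),
        kernel_proper (past L) (f L) &
        forall D : fin_itv, points L `<=` points D ->
        forall h : config ne -> \bar R,
          measurable_fun [set: confs_on ne (below (hi L))]
            (h : confs_on ne (below (hi L)) -> \bar R) ->
        forall w : config ne, has_integral (f D w) h ->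
          kact (f D) (kact (f L) h) w = kact (f D) h w].

(* mu k = mu on F_L *)
Definition preserves (L : set int)
    (k : R.-pker (confs ne) ~> (confs_on ne L))
    (mu : probability (confs ne) R) : Prop :=
  forall h : config ne -> \bar R,
    measurable_fun [set: confs_on ne L] (h : confs_on ne L -> \bar R) ->
    has_integral mu h ->
    \int[mu]_w kact k h w = \int[mu]_w h w.

(* The set G(f) of the chains consistent with f. *)
Definition consistent_chains
    (f : forall L : fin_itv,
       R.-pker (confs ne) ~> (confs_on ne (below (hi L)))) :
    set (probability (confs ne) R) :=
  [set mu | forall L : fin_itv, preserves (f L) mu].

End kernels.

(* Main.v *)
Require Import Defs.
From mathcomp Require Import all_boot all_order all_algebra.
From mathcomp Require Import all_classical all_reals all_analysis.
From mathcomp Require Import measurable_realfun zify.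

(** A single-site kernel [f i] averages over the coordinate [i], given the past
    of [i]: its values [kact (f i) h] are F_{<= i - 1}-measurable, and it leaves
    F_{<= i - 1}-measurable functions unchanged. Every assertion follows from
    these two facts once kernels are regarded as operators [h |-> kact k h] on
    nonnegative functions; the product of kernels then becomes the composition
    of operators ([kact_kcompose]).

    Measurability and properness of a product [f_l ... f_m] are inductions on
    its length. The central identity is absorption, [kact_product_step]:
    [f_l ... f_m f_i = f_l ... f_m] on F_{<= i} for l <= i <= m. Indeed, on a
    function of the coordinates up to [i] the factors beyond [i] act as the
    identity, so that the product reduces to [f_l ... f_i], and
    [f_i f_i = f_i] since [f_i h] depends on the strict past of [i] only.

    Consistency, both of the products with each other and of a chain with the
    products, has the same source, [functional_product]: a functional which is
    invariant under [f_l], ..., [f_m] is invariant under their composition,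
    because the factors can be removed one at a time. It is applied to
    h |-> (f_D h)(w), by absorption, and to h |-> mu(h).

    For uniqueness, let [g] be a specification with single-site kernels [f_i],
    and let m be the right end of D. Consistency with the singleton m gives
    g_D = g_D f_m. Moreover f_m h is F_{<= m - 1}-measurable, and on that
    algebra g_D agrees with g_{D'}, where D' is D without m: by consistency
    g_D = g_D g_{D'}, where g_{D'} yields functions of the past, which g_D
    fixes. Hence g_D = g_{D'} f_m, the recursion that defines the product.

    All of this concerns nonnegative functions; the integrable ones follow by
    splitting into positive and negative parts ([integral_kact_of_ge0]). *)

Import Order.TTheory GRing.Theory Num.Theory.

Local Open Scope classical_set_scope.
Local Open Scope ring_scope.
Local Open Scope ereal_scope.

(** * Integration under a change of measurable space *)

Section change_of_algebra.
Context {R : realType}.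

(** Used below with [phi] the identity between two sigma-algebras on the
    configurations: although the integral is built from the simple functions
    of one algebra, its value is the same on every algebra for which the
    function is measurable and on which the measures agree. *)
Lemma ge0_integral_image (d1 d2 : measure_display) (T1 : measurableType d1)
    (T2 : measurableType d2) (phi : T1 -> T2)
    (mu1 : {measure set T1 -> \bar R}) (mu2 : {measure set T2 -> \bar R})
    (h : T2 -> \bar R) :
  measurable_fun setT phi ->
  (forall A, measurable A -> mu2 A = mu1 (phi @^-1` A)) ->
  measurable_fun setT h -> (forall x, 0 <= h x) ->
  \int[mu2]_y h y = \int[mu1]_x h (phi x).
Proof.
move=> mphi mu12 mh h0.
rewrite -(@ge0_integral_pushforward _ _ _ _ R phi mphi mu1 setT h)//.
by apply: eq_measure_integral => A mA _; exact: mu12.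
Qed.

(** The unparameterized composition is the parameterized one, for a second
    kernel that ignores its first argument. *)
Lemma integral_kcomp_noparam (d0 d1 d2 : measure_display)
    (T0 : measurableType d0) (T1 : measurableType d1) (T2 : measurableType d2)
    (k1 : R.-spker T0 ~> T1) (k2 : R.-spker T1 ~> T2) (x : T0)
    (h : T2 -> \bar R) :
  measurable_fun setT h -> (forall z, 0 <= h z) ->
  \int[mkcomp_noparam k1 k2 x]_z h z = \int[k1 x]_y \int[k2 y]_z h z.
Proof.
by move=> mh h0; rewrite -(integral_kcomp k1 (kernel.kernel_snd k2)).
Qed.

End change_of_algebra.

(** * Kernels as operators on functions of the configuration *)

Section kernels_on_configurations.
Context {R : realType} {d : measure_display} {E : measurableType d}.
Context {Omega : set (int -> E)} {ne : Omega !=set0}.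

Local Notation proj := (@Defs.coord d E Omega ne).

(** F_M-measurability for functions on the bare type of configurations, which
    carries no sigma-algebra of its own: one function is measured against many
    of them. *)
Definition Fmeas (M : set int) (h : config ne -> \bar R) : Prop :=
  measurable_fun [set: confs_on ne M] (h : confs_on ne M -> \bar R).

Lemma measurable_coord (L : set int) (i : int) : L i ->
  measurable_fun setT (proj i : confs_on ne L -> E).
Proof.
move=> Li _ B mB; apply: sub_sigma_algebra.
by exists i => //; exists B.
Qed.

Lemma measurable_to_confs_on (d' : measure_display) (T : measurableType d')
    (L : set int) (phi : T -> confs_on ne L) :
  (forall i, L i -> measurable_fun setT (fun x => proj i (phi x))) ->
  measurable_fun setT phi.
Proof.
move=> mphi.
apply: (@measurability _ _ T (confs_on ne L) setT phi (coord_events proj L)) => //.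
move=> _ [_ [i Li [B mB <-]] <-].
by rewrite !setTI; have := mphi _ Li measurableT _ mB; rewrite setTI.
Qed.

Lemma measurable_confs_on_id (M L : set int) : M `<=` L ->
  measurable_fun setT (idfun : confs_on ne L -> confs_on ne M).
Proof.
by move=> ML; apply: measurable_to_confs_on => i /ML; exact: measurable_coord.
Qed.

Lemma measurable_confs_id (L : set int) :
  measurable_fun setT (idfun : confs ne -> confs_on ne L).
Proof.
apply: measurable_to_confs_on => i _ _ B mB.
exists ((fun w : path_space E => w i) @^-1` B).
  by apply: sub_sigma_algebra; exists i => //; exists B => //; rewrite setTI.
by rewrite !setTI.
Qed.

Lemma Fmeas_sub (M L : set int) (h : config ne -> \bar R) :
  M `<=` L -> Fmeas M h -> Fmeas L h.
Proof.
by move=> /measurable_confs_on_id ML mh; exact: (measurableT_comp mh ML).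
Qed.

Lemma kact_ge0 (L : set int) (k : R.-pker (confs ne) ~> (confs_on ne L)) h :
  (forall x, 0 <= h x) -> forall w, 0 <= kact k h w.
Proof. by move=> h0 w; exact: integral_ge0. Qed.

Lemma kact_indic (L : set int) (k : R.-pker (confs ne) ~> (confs_on ne L))
    (A : set (confs_on ne L)) : measurable A ->
  kact k (fun s => (\1_A s)%:E) = (fun w => k w A).
Proof.
move=> mA; apply/funext => w; rewrite /kact.
by rewrite (@integral_indic _ (confs_on ne L))// setIT.
Qed.

Lemma Fmeas_kact (M L : set int) (k : R.-pker (confs ne) ~> (confs_on ne L))
    (h : config ne -> \bar R) :
  kernel_measurable M k -> Fmeas L h -> (forall x, 0 <= h x) ->
  Fmeas M (kact k h).
Proof.
move=> mk mh h0.
exact: (@measurable_fun_integral_kernel _ _ (confs_on ne M) (confs_on ne L) R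
          (fun w => k w) mk).
Qed.

(** On F_M the measure [k w] is the Dirac mass at [w]. *)
Lemma kact_proper (M L : set int) (k : R.-pker (confs ne) ~> (confs_on ne L))
    (h : config ne -> \bar R) :
  M `<=` L -> kernel_proper M k -> Fmeas M h -> (forall x, 0 <= h x) ->
  kact k h = h.
Proof.
move=> ML pk mh h0; apply/funext => w; rewrite /kact.
rewrite -(@ge0_integral_image R _ _ (confs_on ne L) (confs_on ne M) idfun
  (k w) (\d_(w : confs_on ne M))%R h (measurable_confs_on_id _ _ ML))//.
  by rewrite (@integral_dirac _ (confs_on ne M))// diracT mul1e.
by move=> A mA; rewrite preimage_id pk// /dirac.
Qed.

Lemma kact_kcompose (M L : set int)
    (k1 : R.-pker (confs ne) ~> (confs_on ne M))
    (k2 : R.-pker (confs ne) ~> (confs_on ne L)) (mk2 : kernel_measurable M k2)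
    (h : config ne -> \bar R) :
  Fmeas L h -> (forall x, 0 <= h x) ->
  kact (kcompose k1 mk2) h = kact k1 (kact k2 h).
Proof.
move=> mh h0; apply/funext => w.
exact: (@integral_kcomp_noparam R _ _ _ (confs ne) (confs_on ne M)
  (confs_on ne L) k1 (ksource k2 : R.-spker _ ~> _)).
Qed.

(** For integrable [h], invariance on nonnegative functions shows that the
    images of the two parts of [h] have finite integrals, so that the integral
    of their difference can be split. The operator is evaluated along [phi]
    because [mu] may live on any algebra that makes [h] measurable. *)
Lemma integral_kact_of_ge0 (d' : measure_display) (T : measurableType d')
    (mu : {measure set T -> \bar R}) (M L : set int)
    (k : R.-pker (confs ne) ~> (confs_on ne L)) (phi : T -> config ne) :
  measurable_fun setT (phi : T -> confs_on ne M) ->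
  measurable_fun setT (phi : T -> confs_on ne L) ->
  kernel_measurable M k ->
  (forall h, Fmeas L h -> (forall x, 0 <= h x) ->
    \int[mu]_x kact k h (phi x) = \int[mu]_x h (phi x)) ->
  forall h, Fmeas L h ->
    (forall x, 0 <= h x) \/ mu.-integrable setT (h \o phi) ->
    \int[mu]_x kact k h (phi x) = \int[mu]_x h (phi x).
Proof.
move=> mphiM mphiL mk ge0 h mh [h0|ih]; first exact: ge0.
have mhp : Fmeas L h^\+ := measurable_funepos mh.
have mhn : Fmeas L h^\- := measurable_funeneg mh.
have integrable_kact g : Fmeas L g -> (forall x, 0 <= g x) ->
    mu.-integrable setT (g \o phi) ->
    mu.-integrable setT (kact k g \o phi).
  move=> mg g0 /integrableP[_ gfin]; apply/integrableP; split.
    by apply: (measurableT_comp (Fmeas_kact _ _ _ _ mk mg g0) mphiM).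
  rewrite (eq_integral (fun x => kact k g (phi x))); last first.
    by move=> x _; rewrite gee0_abs//; exact: kact_ge0.
  rewrite ge0// (eq_integral (fun x => `|(g \o phi) x|))// => x _.
  by rewrite /= gee0_abs.
have hp0 x : 0 <= h^\+ x := funepos_ge0 h x.
have hn0 x : 0 <= h^\- x := funeneg_ge0 h x.
have hpE : (h \o phi)^\+ = h^\+ \o phi.
  by apply/funext => x /=; rewrite !funeposE.
have hnE : (h \o phi)^\- = h^\- \o phi.
  by apply/funext => x /=; rewrite !funenegE.
have := integrable_funepos measurableT ih.
have := integrable_funeneg measurableT ih.
rewrite hpE hnE => ihn ihp.
transitivity (\int[mu]_x (kact k h^\+ (phi x) - kact k h^\- (phi x))).
  by apply: eq_integral => x _; rewrite /kact integralE.
rewrite integralB//; [|exact: (integrable_kact _ mhp hp0)|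
  exact: (integrable_kact _ mhn hn0)].
rewrite ge0// ge0// -[RHS]/(\int[mu]_x (h \o phi) x).
by rewrite [RHS]integralE hpE hnE.
Qed.

Lemma Fmeas_indic (L : set int) (A : set (confs_on ne L)) : measurable A ->
  Fmeas L (fun s => (\1_A s)%:E).
Proof.
move=> mA; apply/measurable_EFinP.
exact: (@measurable_indic _ (confs_on ne L)).
Qed.

(** Properties of the operator give back those of the kernel, by evaluation at
    indicator functions. *)
Lemma kernel_measurableP (M L : set int)
    (k : R.-pker (confs ne) ~> (confs_on ne L)) :
  (forall h, Fmeas L h -> (forall x, 0 <= h x) -> Fmeas M (kact k h)) ->
  kernel_measurable M k.
Proof.
move=> kM A mA; rewrite -kact_indic//; apply: kM; first exact: Fmeas_indic.
by move=> x; rewrite lee_fin.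
Qed.

Lemma kernel_properP (M L : set int)
    (k : R.-pker (confs ne) ~> (confs_on ne L)) : M `<=` L ->
  (forall h, Fmeas M h -> (forall x, 0 <= h x) -> kact k h = h) ->
  kernel_proper M k.
Proof.
move=> ML kM B mB w.
have mB' : measurable (B : set (confs_on ne L)).
  by have := measurable_confs_on_id _ _ ML measurableT _ mB; rewrite setTI.
rewrite -[LHS](congr1 (fun h => h w) (kact_indic _ k B mB')).
by rewrite kM//; exact: Fmeas_indic.
Qed.

Lemma eq_kact (M L : set int) (k : R.-pker (confs ne) ~> (confs_on ne L))
    (k' : R.-pker (confs ne) ~> (confs_on ne M)) : M `<=` L ->
  (forall (A : set (confs_on ne M)), measurable A ->
    forall w, k w A = k' w A) ->
  forall h, Fmeas M h -> (forall x, 0 <= h x) -> kact k h = kact k' h.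
Proof.
move=> ML kk' h mh h0; apply/funext => w; apply/esym.
apply: (@ge0_integral_image R _ _ (confs_on ne L) (confs_on ne M) idfun
  (k w) (k' w) h (measurable_confs_on_id _ _ ML)) => // A mA.
by rewrite kk'.
Qed.

Lemma below_le (i j : int) : (i <= j)%R -> below i `<=` below j.
Proof. by move=> ij k /le_trans; exact. Qed.

End kernels_on_configurations.

(** * Products of single-site kernels *)

Section products.
Context {R : realType} {d : measure_display} {E : measurableType d}.
Context {Omega : set (int -> E)} {ne : Omega !=set0}.
Context {f : forall i : int, R.-pker (confs ne) ~> (confs_on ne (below i))}.
Context (fa : forall i : int, kernel_measurable (below (i - 1)%R) (f i)).
Context (fb : forall i : int, kernel_proper (below (i - 1)%R) (f i)).

Lemma Fmeas_step i h : Fmeas (below i) h -> (forall x, 0 <= h x) ->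
  Fmeas (below (i - 1)%R) (kact (f i) h).
Proof. exact: Fmeas_kact. Qed.

Lemma kact_step_id i j h : (j < i)%R -> Fmeas (below j) h ->
  (forall x, 0 <= h x) -> kact (f i) h = h.
Proof.
move=> ji mh h0; apply: (kact_proper (below (i - 1)%R)) => //.
  by apply: below_le; lia.
by apply: Fmeas_sub mh; apply: below_le; lia.
Qed.

Lemma kact_productS l n h : Fmeas (below (l + n.+1%:Z)%R) h ->
  (forall x, 0 <= h x) ->
  kact (kproduct_from fa l n.+1) h =
  kact (kproduct_from fa l n) (kact (f (l + n.+1%:Z)%R) h).
Proof. exact: kact_kcompose. Qed.

Lemma Fmeas_stepS l n h : Fmeas (below (l + n.+1%:Z)%R) h ->
  (forall x, 0 <= h x) ->
  Fmeas (below (l + n%:Z)%R) (kact (f (l + n.+1%:Z)%R) h).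
Proof.
move=> mh h0; apply: Fmeas_sub (Fmeas_step _ _ mh h0).
by apply: below_le; lia.
Qed.

Lemma Fmeas_product l n h : Fmeas (below (l + n%:Z)%R) h ->
  (forall x, 0 <= h x) ->
  Fmeas (below (l - 1)%R) (kact (kproduct_from fa l n) h).
Proof.
elim: n h => [|n IHn] h mh h0.
  apply: Fmeas_sub (Fmeas_step _ _ mh h0).
  by apply: below_le; lia.
rewrite kact_productS//; apply: IHn; first exact: Fmeas_stepS.
exact: kact_ge0.
Qed.

Lemma kact_product_past l n h : Fmeas (below (l - 1)%R) h ->
  (forall x, 0 <= h x) -> kact (kproduct_from fa l n) h = h.
Proof.
move=> mh h0; elim: n => [|n IHn].
  by apply: (kact_step_id _ (l - 1)%R) => //; lia.
rewrite kact_productS//; last by apply: Fmeas_sub mh; apply: below_le; lia.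
by rewrite (kact_step_id _ (l - 1)%R)//; lia.
Qed.

(** Absorption: the factors beyond [i] are the identity on both sides, and
    [f i] is idempotent because its values depend on the past of [i] alone. *)
Lemma kact_product_step l n i h : (l <= i <= l + n%:Z)%R ->
  Fmeas (below i) h -> (forall x, 0 <= h x) ->
  kact (kproduct_from fa l n) (kact (f i) h) = kact (kproduct_from fa l n) h.
Proof.
move=> + mh h0; have fh0 := kact_ge0 _ (f i) _ h0.
have mfh := Fmeas_step _ _ mh h0.
elim: n => [|n IHn] lin.
  (* Here [i = l]: the left-hand side is [f l (f l h)], and the outer factor
     fixes [f l h]. *)
  by rewrite [LHS](kact_step_id _ (i - 1)%R)//=; [congr (kact (f _) h) |]; lia.
have mh' : Fmeas (below (l + n.+1%:Z)%R) h.
  by apply: Fmeas_sub mh; apply: below_le; lia.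
rewrite !kact_productS//; last first.
  by apply: Fmeas_sub mfh; apply: below_le; lia.
rewrite (kact_step_id _ (i - 1)%R _ _ mfh)//; last by lia.
have [->//|iSn] := eqVneq i (l + n.+1%:Z)%R.
by rewrite (kact_step_id (l + n.+1%:Z)%R i)//; [apply: IHn|]; lia.
Qed.

(** The factors are removed from the left of the product inside [I]: the
    induction hypothesis removes the first [n] of them from the function
    [f (l + n + 1) h], then the assumption on [I] removes the last one. The
    functional is integration against [mu], or against a larger product. *)
Lemma functional_product (I : (config ne -> \bar R) -> \bar R) l n :
  (forall i h, (l <= i <= l + n%:Z)%R -> Fmeas (below i) h ->
    (forall x, 0 <= h x) -> I (kact (f i) h) = I h) ->
  forall h, Fmeas (below (l + n%:Z)%R) h -> (forall x, 0 <= h x) ->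
  I (kact (kproduct_from fa l n) h) = I h.
Proof.
elim: n => [|n IHn] If h mh h0; first by apply: If => //; lia.
rewrite kact_productS// IHn; [|by move=> *; apply: If => //; lia|
  exact: Fmeas_stepS|exact: kact_ge0].
by apply: If => //; lia.
Qed.

Lemma below_past_hi L : past L `<=` below (hi L).
Proof. by apply: below_le; rewrite /hi; lia. Qed.

Lemma kernel_measurable_product L :
  kernel_measurable (past L) (interval_kernel fa L).
Proof. by apply: kernel_measurableP => h; exact: Fmeas_product. Qed.

Lemma points_le (L D : fin_itv) : points L `<=` points D ->
  (lo D <= lo L)%R /\ (hi L <= hi D)%R.
Proof.
move=> LD.
have /andP[loLD _] : points D (lo L) by apply: LD; rewrite /points /hi/=; lia.
have /andP[_ hiLD] : points D (hi L) by apply: LD; rewrite /points /hi/=; lia.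
by [].
Qed.

(** * The product is a specification, with the expected chains *)

Lemma product_specification : left_interval_specification (interval_kernel fa).
Proof.
move=> L; split.
- exact: kernel_measurable_product.
- apply: kernel_properP => [|h]; [exact: below_past_hi|].
  exact: kact_product_past.
move=> D /points_le[loLD hiLD] h mh w ih.
have pastD : past L `<=` below (hi D).
  by apply: subset_trans (below_past_hi L) _; exact: below_le.
apply: (@integral_kact_of_ge0 R d E Omega ne _ (confs_on ne (below (hi D)))
  (interval_kernel fa D w) (past L) (below (hi L)) (interval_kernel fa L)
  idfun) => //.
- exact: measurable_confs_on_id.
- by apply: measurable_confs_on_id; exact: below_le.
- exact: kernel_measurable_product.
apply: (functional_product (fun g => kact (interval_kernel fa D) g w)) => i g.
move=> iL mg g0 /=; rewrite /interval_kernel kact_product_step//.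
by move: iL loLD hiLD; rewrite /hi; lia.
Qed.

Lemma product_singleton (i : int) (A : set (confs_on ne (below i))) :
  measurable A ->
  forall w : config ne, interval_kernel fa (singleton i) w A = f i w A.
Proof.
(* [f (i + 0)] and [f i] have different types, so that [i + 0] can be replaced
   only after it is generalized. *)
move=> _ w; have same j : j = i -> f j w A = f i w A by move=> ->.
exact: same (addr0 i).
Qed.

Lemma product_chains : consistent_chains (interval_kernel fa) =
  [set mu : probability (confs ne) R | forall i : int, preserves (f i) mu].
Proof.
apply/seteqP; split => mu /= muf.
  move=> i h mh ih.
  have same j : j = i -> preserves (f j) mu -> preserves (f i) mu by move=> ->.
  by apply: (same (i + 0%:Z)%R) mh ih; [exact: addr0|exact: muf (singleton i)].
move=> L h mh ih.
apply: (@integral_kact_of_ge0 R d E Omega ne _ (confs ne)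
  mu (past L) (below (hi L)) (interval_kernel fa L) idfun) => //.
- exact: measurable_confs_id.
- exact: measurable_confs_id.
- exact: kernel_measurable_product.
apply: (functional_product (fun g => \int[mu]_w g w)) => i g _ mg g0.
by apply: muf => //; left.
Qed.

(** * Uniqueness *)

Section uniqueness.
Context (g : forall L : fin_itv,
  R.-pker (confs ne) ~> (confs_on ne (below (hi L)))).
Context (gspec : left_interval_specification g).
Context (gf : forall (i : int) (A : set (confs_on ne (below i))),
  measurable A -> forall w : config ne, g (singleton i) w A = f i w A).

Lemma specification_consistent L D h : points L `<=` points D ->
  Fmeas (below (hi L)) h -> (forall x, 0 <= h x) ->
  kact (g D) (kact (g L) h) = kact (g D) h.
Proof.
move=> LD mh h0; apply/funext => w.
by have [_ _ ->//] := gspec L; left.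
Qed.

(** Two intervals with the same left end have the same past. The values of
    [g L] depend on that past only, so [g D] fixes them, while consistency
    says that [g D] after [g L] is [g D]. *)
Lemma specification_restrict L D h : points L `<=` points D -> lo D = lo L ->
  Fmeas (below (hi L)) h -> (forall x, 0 <= h x) ->
  kact (g D) h = kact (g L) h.
Proof.
move=> LD loLD mh h0; rewrite -(specification_consistent _ _ _ LD)//.
have [gLm _ _] := gspec L; have [_ gDp _] := gspec D.
apply: (kact_proper _ _ _ _ (below_past_hi D) gDp); last exact: kact_ge0.
by rewrite /past loLD; exact: Fmeas_kact.
Qed.

Lemma specification_singleton i h : Fmeas (below i) h ->
  (forall x, 0 <= h x) -> kact (g (singleton i)) h = kact (f i) h.
Proof.
move=> mh h0; apply: eq_kact (gf i) _ mh h0.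
by apply: below_le; rewrite /hi /=; lia.
Qed.

(** Both sides obey the same recursion: remove the right end point as a
    singleton, then restrict to the remaining interval. *)
Lemma specification_product l n h : Fmeas (below (l + n%:Z)%R) h ->
  (forall x, 0 <= h x) ->
  kact (g (FinItv l n)) h = kact (kproduct_from fa l n) h.
Proof.
elim: n h => [|n IHn] h mh h0.
  by rewrite /= addr0 -specification_singleton// -[l in below l]addr0.
rewrite kact_productS// -IHn; [|exact: Fmeas_stepS|exact: kact_ge0].
rewrite -(specification_restrict (FinItv l n) (FinItv l n.+1))//; first last.
- exact: kact_ge0.
- exact: Fmeas_stepS.
- by move=> i; rewrite /points /hi /=; lia.
rewrite -specification_singleton// specification_consistent//.
  by move=> i; rewrite /points /hi /=; lia.
by rewrite /hi /= addr0.
Qed.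

Lemma product_unique (L : fin_itv) (A : set (confs_on ne (below (hi L)))) :
  measurable A -> forall w : config ne, g L w A = interval_kernel fa L w A.
Proof.
case: L A => l n A mA w.
rewrite -[LHS](congr1 (fun h => h w) (kact_indic _ (g _) A mA)).
rewrite -[RHS](congr1 (fun h => h w)
  (kact_indic _ (interval_kernel fa _) A mA)).
rewrite specification_product//; exact: Fmeas_indic.
Qed.

End uniqueness.

End products.

Theorem theorem3p1 (R : realType) (d : measure_display)
    (E : measurableType d) (Omega : set (int -> E)) (ne : Omega !=set0)
    (f : forall i : int, R.-pker (confs ne) ~> (confs_on ne (below i)))
    (fa : forall i : int, kernel_measurable (below (i - 1)%R) (f i))
    (fb : forall i : int, kernel_proper (below (i - 1)%R) (f i)) :
  [/\ left_interval_specification (interval_kernel fa),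
      forall (i : int) (A : set (confs_on ne (below i))), measurable A ->
        forall w : config ne, interval_kernel fa (singleton i) w A = f i w A,
      forall g : (forall L : fin_itv,
          R.-pker (confs ne) ~> (confs_on ne (below (hi L)))),
        left_interval_specification g ->
        (forall (i : int) (A : set (confs_on ne (below i))), measurable A ->
          forall w : config ne, g (singleton i) w A = f i w A) ->
        forall (L : fin_itv) (A : set (confs_on ne (below (hi L)))),
          measurable A ->
          forall w : config ne, g L w A = interval_kernel fa L w A
    & consistent_chains (interval_kernel fa) =
      [set mu : probability (confs ne) R | forall i : int, preserves (f i) mu]].
Proof.
split.
- exact: product_specification.
- exact: product_singleton.
- exact: product_unique.
- exact: product_chains.
Qed.
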